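(* Let $m,n\ge 1$ and $a\ge 2$ be integers. If $n\ge 2a+2$ or else $a\ge 2n$, then $\chi_{lt}(mC_6+nP_6+aP_3)=2n+2a+1$. Otherwise: (i) if $n=2a+1$ or else $a\in[n+1,2n-1]$, then $2n+2a+1\le \chi_{lt}(mC_6+nP_6+aP_3)\le 2n+2a+2$; (ii) if $n=2a$ or else $a=n$, then $2n+2a+1\le \chi_{lt}(mC_6+nP_6+aP_3)\le 2n+2a+3$; (iii) if $n\in[a+1,2a-1]$ or else $a=n-1$, then $2n+2a+1\le \chi_{lt}(mC_6+nP_6+aP_3)\le 2n+2a+4$; (iv) if $n\le a$ or else $a\le n-2$, then $2n+2a+1\le \chi_{lt}(mC_6+nP_6+aP_3)\le 2n+2a+5$.
   Context: $[a,b]$ denotes the set of integers $n$ with $a\le n\le b$. $G+H$ is the disjoint union of $G$ and $H$, $mG$ is the disjoint union of $m$ copies of $G$, $P_n$ is the path on $n$ vertices and $C_n$ is the cycle on $n$ vertices. For a finite simple graph $G=(V,E)$ of order $p$ and size $q$, a local total antimagic labeling is a bijection $f:V\cup E\to\{1,\dots,p+q\}$ such that, with weights $w_f(u)=\sum f(e)$ over all edges $e$ incident to $u$ for $u\in V$ (the label of $u$ itself is not included) and $w_f(uv)=f(u)+f(v)$ for $uv\in E$, one has: adjacent vertices have distinct weights, adjacent edges have distinct weights, and every vertex has a weight distinct from that of each of its incident edges. $\chi_{lt}(G)$ is the minimum, over all local total antimagic labelings $f$ of $G$, of the number of distinct values among all the vertex and edge weights. *)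

(* Defs.v *)
From mathcomp Require Import all_boot.

Set Implicit Arguments.
Unset Strict Implicit.
Unset Printing Implicit Defensive.

Record sgraph := SGraph {
  vertex :> finType;
  adj : rel vertex;
  adj_sym : symmetric adj;
  adj_irr : irreflexive adj }.

Arguments adj {s} : rename.

Lemma path_graph_sym n :
  symmetric (fun i j : 'I_n => (i.+1 == j) || (j.+1 == i)).
Proof. by move=> i j; rewrite orbC. Qed.

Lemma path_graph_irr n :
  irreflexive (fun i j : 'I_n => (i.+1 == j) || (j.+1 == i)).
Proof. by move=> i; rewrite orbb gtn_eqF. Qed.

Definition path_graph n := SGraph (@path_graph_sym n) (@path_graph_irr n).

(* [ordS] is the cyclic successor in ['I_n].  The guard [i != j] only matters
   for n = 1; the cycle C_n is meant for n >= 3. *)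
Lemma cycle_graph_sym n :
  symmetric (fun i j : 'I_n => (i != j) && ((ordS i == j) || (ordS j == i))).
Proof. by move=> i j; rewrite eq_sym orbC. Qed.

Lemma cycle_graph_irr n :
  irreflexive (fun i j : 'I_n => (i != j) && ((ordS i == j) || (ordS j == i))).
Proof. by move=> i; rewrite eqxx. Qed.

Definition cycle_graph n := SGraph (@cycle_graph_sym n) (@cycle_graph_irr n).

Definition union_adj (G H : sgraph) : rel (G + H) := fun x y =>
  match x, y with
  | inl u, inl v => adj u v
  | inr u, inr v => adj u v
  | _, _ => false
  end.

Lemma union_adj_sym G H : symmetric (@union_adj G H).
Proof. by case=> u [] v //=; apply: adj_sym. Qed.

Lemma union_adj_irr G H : irreflexive (@union_adj G H).
Proof. by case=> u /=; apply: adj_irr. Qed.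

Definition disjoint_union G H := SGraph (@union_adj_sym G H) (@union_adj_irr G H).

Definition copies_adj m (G : sgraph) : rel ('I_m * G) := fun x y =>
  (x.1 == y.1) && adj x.2 y.2.

Lemma copies_adj_sym m G : symmetric (@copies_adj m G).
Proof. by move=> x y; rewrite /copies_adj eq_sym adj_sym. Qed.

Lemma copies_adj_irr m G : irreflexive (@copies_adj m G).
Proof. by move=> x; rewrite /copies_adj adj_irr andbF. Qed.

Definition copies m G := SGraph (@copies_adj_sym m G) (@copies_adj_irr m G).

Definition edges (G : sgraph) : {set {set G}} :=
  [set e : {set G} | [exists u, exists v, adj u v && (e == [set u; v])]].

Definition edge (G : sgraph) := {e : {set G} | e \in edges G}.

Definition element (G : sgraph) := (G + edge G)%type.

Definition order_size (G : sgraph) := #|G| + #|edges G|.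

(* Labels live in {0, ..., p + q}; being a bijection onto {1, ..., p + q}
   is imposed by [total_labeling]. *)
Definition labeling (G : sgraph) := {ffun element G -> 'I_(order_size G).+1}.

Definition total_labeling (G : sgraph) (f : labeling G) : bool :=
  injectiveb f && (f @: [set: element G] == [set k : 'I_(order_size G).+1 | 1 <= k]).

Definition vertex_weight (G : sgraph) (f : labeling G) (u : G) : nat :=
  \sum_(e : edge G | u \in val e) f (inr e).

Definition edge_weight (G : sgraph) (f : labeling G) (e : edge G) : nat :=
  \sum_(u in val e) f (inl u).

Definition weight (G : sgraph) (f : labeling G) (x : element G) : nat :=
  match x with
  | inl u => vertex_weight f u
  | inr e => edge_weight f e
  end.

Definition local_total_antimagic (G : sgraph) (f : labeling G) : bool :=
  [&& total_labeling f,
      [forall u : G, forall v : G,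
         adj u v ==> (vertex_weight f u != vertex_weight f v)],
      [forall e1 : edge G, forall e2 : edge G,
         (e1 != e2) && (val e1 :&: val e2 != set0) ==>
           (edge_weight f e1 != edge_weight f e2)]
    & [forall u : G, forall e : edge G,
         (u \in val e) ==> (vertex_weight f u != edge_weight f e)]].

Definition num_weights (G : sgraph) (f : labeling G) : nat :=
  size (undup [seq weight f x | x : element G]).

(* The junk value 0 is taken when G has no local total antimagic labeling;
   the number of weights of a labeling is positive unless G is empty. *)
Definition chi_lt (G : sgraph) : nat :=
  if [pick f : labeling G | local_total_antimagic f] is Some f0 then
    num_weights [arg min_(f < f0 | local_total_antimagic f) num_weights f]
  else 0.

Definition C6_P6_P3 m n a : sgraph :=
  disjoint_union
    (disjoint_union (copies m (cycle_graph 6)) (copies n (path_graph 6)))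
    (copies a (path_graph 3)).

(* Main.v *)
Require Import Defs.
From mathcomp Require Import all_boot zify.

(* The 2n + 2a pendant vertices have the labels of their edges as weights, and
   the element with the largest label contributes to a weight exceeding all
   labels, so there are always at least L = 2n + 2a + 1 weights. One labeling
   attains this bound for all m, n >= 1 and a >= 2, hence chi = L throughout.
   With p + q = M - 1, every weight of that labeling other than those of the
   pendant vertices is M, M - 1 or M - 2, and the pendant edges of the first two
   P3's carry M - 1 and M - 2. Along each component, weights of consecutive
   elements (vertex, edge, vertex, ...) repeat with period 3. The vertices of a
   C6, the edges of a C6 and the vertices of a P6 each take a hexagon: six labels
   in cyclic order whose consecutive sums are M, M-1, M-2, M, M-1, M-2. The low
   labels 1, 2, ... and the high labels M-1, M-2, ... are used up from both ends,
   in the order: edges of the P3's, edges of the first P6, hexagons, vertices of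
   the P3's, edges of the other P6's. After the hexagons the number of high labels
   used exceeds the number of low ones by 1; each later block toggles this excess
   between 1 and 2, so these blocks come in two complementary types. *)

Set Implicit Arguments.
Unset Strict Implicit.
Unset Printing Implicit Defensive.

(** * Enumerated edges *)

(** Each edge has one index and one orientation, so that sums over edges run over a concrete finite
    type rather than over two-element sets. *)
Definition edge_enum (G : sgraph) (E : finType) (ends : E -> G * G) : Prop :=
  (forall e e', ends e = ends e' \/ ends e = ((ends e').2, (ends e').1) ->
     e = e') /\
  (forall u v, adj u v <-> exists e, ends e = (u, v) \/ ends e = (v, u)).

Definition incident (G : sgraph) (E : finType) (ends : E -> G * G) u e :=
  (u == (ends e).1) || (u == (ends e).2).

Definition star_sum (G : sgraph) (E : finType) (ends : E -> G * G)
    (l : E -> nat) u : nat :=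
  \sum_(e | incident ends u e) l e.

Section EdgeEnum.

Variables (G : sgraph) (E : finType) (ends : E -> G * G).
Hypothesis enum_ends : edge_enum ends.

Let ends_set e : {set G} := [set (ends e).1; (ends e).2].

Lemma adj_ends e : adj (ends e).1 (ends e).2.
Proof. by apply/(enum_ends.2); exists e; left; case: (ends e). Qed.

Lemma ends_neq e : (ends e).1 != (ends e).2.
Proof. by apply/eqP=> eq12; have := adj_ends e; rewrite eq12 adj_irr. Qed.

Lemma edgesP (s : {set G}) :
  reflect (exists e, s = ends_set e) (s \in edges G).
Proof.
rewrite inE; apply: (iffP existsP) => [[u /existsP[v /andP[uv /eqP->]]]|[e ->]].
  have [e [] he] := (enum_ends.2 u v).1 uv; exists e; rewrite /ends_set he //=.
  by rewrite setUC.
by exists (ends e).1; apply/existsP; exists (ends e).2; rewrite adj_ends /=.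
Qed.

Lemma ends_set_edge e : ends_set e \in edges G.
Proof. by apply/edgesP; exists e. Qed.

Definition edge_of e : edge G := exist _ (ends_set e) (ends_set_edge e).

Lemma mem_edge_of u e : (u \in val (edge_of e)) = incident ends u e.
Proof. by rewrite !inE. Qed.

Lemma edge_of_inj : injective edge_of.
Proof.
move=> e e' /(congr1 val) /= /setP eq_e; apply: enum_ends.1.
have := ends_neq e; have := eq_e (ends e).1; have := eq_e (ends e).2.
rewrite !inE !eqxx orbT /=; case: (ends e) => u v /=; case: (ends e') => x y /=.
do 2!(move/esym/orP=> [] /eqP->); rewrite ?eqxx // => _; by [left|right].
Qed.

Lemma edge_ofP (x : edge G) : exists e, x = edge_of e.
Proof.
have [e he] := edgesP _ (valP x); by exists e; apply: val_inj; rewrite he.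
Qed.

Lemma edge_of_bij : bijective edge_of.
Proof.
apply: inj_card_bij edge_of_inj _.
rewrite -(card_codom edge_of_inj); apply/subset_leq_card/subsetP=> x _.
by have [e ->] := edge_ofP x; apply: codom_f.
Qed.

Lemma card_edge_enum : #|edges G| = #|E|.
Proof. by rewrite (bij_eq_card edge_of_bij) card_sig; apply: eq_card. Qed.

Lemma vertex_weight_enum (f : labeling G) u :
  vertex_weight f u = star_sum ends (fun e => f (inr (edge_of e))) u.
Proof.
rewrite /vertex_weight (reindex edge_of); last exact/onW_bij/edge_of_bij.
by apply: eq_bigl => e; rewrite mem_edge_of.
Qed.

Lemma edge_weight_enum (f : labeling G) e :
  edge_weight f (edge_of e) = f (inl (ends e).1) + f (inl (ends e).2).
Proof.
rewrite /edge_weight /= big_setU1 ?big_set1 // inE; exact: ends_neq.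
Qed.

End EdgeEnum.

(** * Edge enumerations of copies, unions, paths and cycles *)

Definition copies_ends (k : nat) (G : sgraph) (E : finType)
    (ends : E -> G * G) (x : 'I_k * E) : copies k G * copies k G :=
  ((x.1, (ends x.2).1), (x.1, (ends x.2).2)).

Lemma edge_enum_copies (k : nat) (G : sgraph) (E : finType)
    (ends : E -> G * G) :
  edge_enum ends -> edge_enum (@copies_ends k G E ends).
Proof.
case=> inj adjP; rewrite /copies_ends; split=> [[i e] [j e'] /=|[i u] [j v]].
  by case=> -[-> h1 _ h2]; congr (_, _); apply: inj; [left|right];
    case: (ends e) h1 h2; case: (ends e') => /= ? ? ? ? -> ->.
split=> [/andP[/eqP/= -> /adjP [e he]]|[[k' e] /= he]].
  by exists (j, e) => /=; case: he => ->; [left|right].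
apply/andP; rewrite /=; case: he => -[<- <- <- <-]; split=> //.
  exact: (@adj_ends _ _ _ (conj inj adjP)).
by rewrite adj_sym; exact: (@adj_ends _ _ _ (conj inj adjP)).
Qed.

Lemma incident_copies (k : nat) (G : sgraph) (E : finType)
    (ends : E -> G * G) (i j : 'I_k) u e :
  incident (copies_ends ends) (i, u) (j, e) = (j == i) && incident ends u e.
Proof. by rewrite /incident /= !xpair_eqE -andb_orr eq_sym. Qed.

Lemma star_sum_copies (k : nat) (G : sgraph) (E : finType)
    (ends : E -> G * G) (l : 'I_k * E -> nat) i u :
  star_sum (copies_ends ends) l (i, u) = star_sum ends (fun e => l (i, e)) u.
Proof.
rewrite /star_sum.
rewrite -[RHS](big_pred1_eq addn i
  (fun i => \sum_(e | incident ends u e) l (i, e))).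
rewrite pair_big /=; apply: eq_big => [[j e]|[j e] _] //=.
by rewrite /incident /= !xpair_eqE -andb_orr eq_sym.
Qed.

Definition union_ends (G H : sgraph) (E F : finType)
    (ends : E -> G * G) (ends' : F -> H * H) (x : E + F) :
    disjoint_union G H * disjoint_union G H :=
  match x with
  | inl e => (inl (ends e).1, inl (ends e).2)
  | inr e => (inr (ends' e).1, inr (ends' e).2)
  end.

Lemma edge_enum_union (G H : sgraph) (E F : finType)
    (ends : E -> G * G) (ends' : F -> H * H) :
  edge_enum ends -> edge_enum ends' -> edge_enum (union_ends ends ends').
Proof.
move=> hG hH; have [injG adjG] := hG; have [injH adjH] := hH; split.
  by case=> e [] e' /= [] // -[h1 h2]; congr (_ _);
    [apply: injG; left|apply: injG; right|apply: injH; left|apply: injH; right];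
    rewrite [LHS]surjective_pairing h1 h2 // -surjective_pairing.
case=> u [] v; split=> //=.
- by move/adjG=> [e he]; exists (inl e) => /=; case: he => ->; [left|right].
- case=> -[] e /= [] // [<- <-]; first exact: adj_ends hG e.
  by rewrite adj_sym; exact: adj_ends hG e.
- by case=> -[] e /= [].
- by case=> -[] e /= [].
- by move/adjH=> [e he]; exists (inr e) => /=; case: he => ->; [left|right].
- case=> -[] e /= [] // [<- <-]; first exact: adj_ends hH e.
  by rewrite adj_sym; exact: adj_ends hH e.
Qed.

Lemma star_sum_inl (G H : sgraph) (E F : finType)
    (ends : E -> G * G) (ends' : F -> H * H) l u :
  star_sum (union_ends ends ends') l (inl u) =
  star_sum ends (fun e => l (inl e)) u.
Proof. by rewrite /star_sum big_sumType /= [X in _ + X]big_pred0 ?addn0. Qed.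

Lemma star_sum_inr (G H : sgraph) (E F : finType)
    (ends : E -> G * G) (ends' : F -> H * H) l u :
  star_sum (union_ends ends ends') l (inr u) =
  star_sum ends' (fun e => l (inr e)) u.
Proof. by rewrite /star_sum big_sumType /= big_pred0. Qed.

Definition path_ends n (j : 'I_n) : path_graph n.+1 * path_graph n.+1 :=
  (widen_ord (leqnSn n) j, lift ord0 j).

Lemma edge_enum_path n : edge_enum (@path_ends n).
Proof.
split=> [i j /= [] [] |u v].
- by move=> h _; apply: val_inj.
- by case: i j => i hi [j hj]; rewrite /bump /= !add1n => h1 h2; exfalso; lia.
split=> [/orP[] /eqP h|[j [] [<- <-]]].
- have hu : u < n by case: v h => v /= hv; lia.
  by exists (Ordinal hu); left; congr (_, _); apply: val_inj;
    rewrite //= /bump leq0n add1n.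
- have hu : v < n by case: u h => u /= hu; lia.
  by exists (Ordinal hu); right; congr (_, _); apply: val_inj;
    rewrite //= /bump leq0n add1n.
- by rewrite /= /bump /= add1n eqxx.
- by rewrite /= /bump /= add1n eqxx orbT.
Qed.

(** Edge [j] joins [j] and [j + 1], so [v] meets edges [v - 1] and [v]; the guards drop the one
    missing at an end. Taking [l] on [nat] avoids bound proofs for [v.-1]. *)
Lemma star_sum_path n (l : nat -> nat) (v : 'I_n.+1) :
  star_sum (@path_ends n) (fun j => l j) v =
  (if 0 < v then l v.-1 else 0) + (if v < n then l v else 0).
Proof.
rewrite /star_sum (bigID (fun j : 'I_n => j == v :> nat)) /= addnC.
congr (_ + _).
  case: v => [[|v] hv] /=.
    by apply: big_pred0 => j; rewrite /incident -!val_eqE /= eq_sym orbF andbN.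
  (* The guard, true here, is put back to match the form of [big_ord1_eq]. *)
  rewrite -[RHS](_ : (if v < n then l v else 0) = _); last by rewrite -ltnS hv.
  rewrite -(big_ord1_eq addn l); apply: eq_bigl => j.
  rewrite /incident -!val_eqE /= /bump leq0n add1n eqSS.
  by rewrite (eq_sym v.+1) andb_orl andbN /=; case: eqVneq => // ->; lia.
rewrite -(big_ord1_eq addn l); apply: eq_bigl => j.
by rewrite /incident -!val_eqE /= eq_sym; case: eqP; rewrite ?andbF.
Qed.

Lemma incident_path_end n b (j : 'I_n.+1) :
  incident (@path_ends n.+1) (if b then ord_max else ord0) j =
  (j == if b then ord_max else ord0).
Proof.
rewrite /incident -!val_eqE /=; case: b => /=; last by rewrite orbF eq_sym.
by rewrite /bump leq0n add1n eqSS gtn_eqF // eq_sym.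
Qed.

Lemma incident_path_ends1 n (j : 'I_n) :
  incident (@path_ends n) (widen_ord (leqnSn n) j) j.
Proof. by rewrite /incident eqxx. Qed.

Lemma incident_path_ends2 n (j : 'I_n) :
  incident (@path_ends n) (lift ord0 j) j.
Proof. by rewrite /incident eqxx orbT. Qed.

Lemma path_vertex_incident n (v : 'I_n.+2) :
  exists e, incident (@path_ends n.+1) v e.
Proof.
case: (unliftP ord0 v) => [j|] ->.
  by exists j; apply: incident_path_ends2.
by exists ord0; rewrite /incident -!val_eqE.
Qed.

Lemma path_edge_neighbor n (e : 'I_n.+2) :
  exists u e', [/\ e' != e, incident (@path_ends n.+2) u e
                & incident (@path_ends n.+2) u e'].
Proof.
case: (unliftP ord0 e) => [j|] ->.
  exists (widen_ord (leqnSn _) (lift ord0 j)), (widen_ord (leqnSn _) j).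
  rewrite incident_path_ends1 /incident -!val_eqE /= /bump leq0n add1n.
  by rewrite ltn_eqF // eqxx orbT.
exists (lift ord0 ord0), (lift ord0 ord0).
by rewrite incident_path_ends2 /incident -!val_eqE.
Qed.

Definition cycle_ends n (j : 'I_n) : cycle_graph n * cycle_graph n :=
  (j, ordS j).

Lemma edge_enum_cycle n : edge_enum (@cycle_ends n.+3).
Proof.
split=> [i j /= []|u v].
- by case.
(* A reversed pair would give [j + 2 = j] modulo the length, which is at least 3; the cases separate
   the two wrap-arounds. *)
- case=> -> /(congr1 val) /= h; exfalso; move: h; case: j => j /= hj.
  have [hj2|hj2] : j.+2 < n.+3 \/ n.+3 <= j.+2 by lia.
    by rewrite (@modn_small j.+1) ?modn_small //; lia.
  have [->|->] : j = n.+1 \/ j = n.+2 by lia.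
    by rewrite (@modn_small n.+2) // modnn.
  by rewrite modnn modn_small.
have ordS_neq (j : 'I_n.+3) : j != ordS j.
  apply/eqP=> /(congr1 val) /=; case: j => j /= hj.
  have [hj2|->] : j.+1 < n.+3 \/ j = n.+2 by lia.
    by rewrite modn_small //; lia.
  by rewrite modnn.
split=> [/andP[_ /orP[] /eqP <-]|[j [] [<- <-]]].
- by exists u; left.
- by exists v; right.
- by rewrite /= ordS_neq eqxx.
- by rewrite /= eq_sym ordS_neq eqxx orbT.
Qed.

Lemma star_sum_cycle n (l : 'I_n.+3 -> nat) v :
  star_sum (@cycle_ends n.+3) l v = l v + l (ord_pred v).
Proof.
have neq : ord_pred v != v.
  have := ends_neq (edge_enum_cycle n) (ord_pred v).
  by rewrite /= ord_predK.
rewrite /star_sum (bigD1 v) /=; last by rewrite /incident eqxx.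
congr (_ + _); rewrite -[RHS](big_pred1_eq addn (ord_pred v) l).
apply: eq_bigl => j.
rewrite /incident /= !(eq_sym v) (can2_eq (@ordSK _) (@ord_predK _)).
by rewrite andb_orl andbN /=; case: eqVneq => // ->.
Qed.

(** * Bounds on the number of weights *)

(** The labeling that attains [k] also rules out the junk value of [chi_lt]. *)
Lemma chi_lt_eq (G : sgraph) (k : nat) :
  (exists2 f : labeling G, local_total_antimagic f & num_weights f <= k) ->
  (forall f : labeling G, local_total_antimagic f -> k <= num_weights f) ->
  chi_lt G = k.
Proof.
move=> [f hf fk] low; rewrite /chi_lt.
case: pickP => [f0 hf0|/(_ f)]; last by rewrite hf.
case: arg_minnP => // g hg min_g; apply/eqP; rewrite eqn_leq low // andbT.
exact: leq_trans (min_g _ hf) fk.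
Qed.

Section Labelings.

Variables (G : sgraph) (E : finType) (ends : E -> G * G).
Hypothesis enum_ends : edge_enum ends.
Let edge_of := edge_of enum_ends.

Section Upper.

Variables (lv : G -> nat) (le : E -> nat).
Let wv := star_sum ends le.
Let we e := lv (ends e).1 + lv (ends e).2.
Let lab (x : G + E) := match x with inl u => lv u | inr e => le e end.

Hypothesis lab_inj : injective lab.
Hypothesis lab_range : forall x, 1 <= lab x <= #|G| + #|E|.
Hypothesis wv_adj : forall e, wv (ends e).1 <> wv (ends e).2.
Hypothesis w_incident1 : forall e, wv (ends e).1 <> we e.
Hypothesis w_incident2 : forall e, wv (ends e).2 <> we e.

Lemma antimagic_of_enum (s : seq nat) :
  (forall u, wv u \in s) -> (forall e, we e \in s) ->
  exists2 f : labeling G, local_total_antimagic f & num_weights f <= size s.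
Proof.
move=> wv_s we_s.
have [enc edge_ofK encK] := edge_of_bij enum_ends.
have sizeE : order_size G = #|G| + #|E|.
  by rewrite /order_size (card_edge_enum enum_ends).
pose g (x : element G) :=
  lab match x with inl u => inl u | inr e => inr (enc e) end.
have g_range x : 1 <= g x <= order_size G by rewrite sizeE; apply: lab_range.
have g_inj : injective g.
  move=> x y /lab_inj; case: x y => [u|e] [v|e'] // [] h; first by rewrite h.
  by rewrite -[e]encK h encK.
pose f : labeling G := [ffun x => inord (g x)].
have fE x : f x = g x :> nat.
  by rewrite ffunE inordK // ltnS; case/andP: (g_range x).
have f_inj : injective f.
  by move=> x y /(congr1 val) /=; rewrite !fE => /g_inj.
have vwE u : vertex_weight f u = wv u.
  rewrite (vertex_weight_enum enum_ends); apply: eq_bigr => e _.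
  by rewrite fE /g edge_ofK.
have ewE e : edge_weight f (edge_of e) = we e.
  by rewrite (edge_weight_enum enum_ends) !fE.
exists f; last first.
  rewrite /num_weights; apply: uniq_leq_size; first exact: undup_uniq.
  move=> w; rewrite mem_undup => /imageP[[u|e] _ ->] /=.
    by rewrite vwE.
  by have [e' ->] := edge_ofP enum_ends e; rewrite ewE.
apply/and4P; split.
- apply/andP; split; first exact/injectiveP.
  (* Surjectivity by counting: the injective image lies in a set of the same size. *)
  rewrite eqEcard; apply/andP; split.
    apply/subsetP=> _ /imsetP[x _ ->].
    by rewrite inE fE; case/andP: (g_range x).
  rewrite card_imset // cardsT card_sum card_sig.
  have -> : #|[pred x | x \in edges G]| = #|edges G| by apply: eq_card.
  rewrite -/(order_size G) (_ : [set _ | _] = ~: [set ord0]).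
    by rewrite cardsC1 card_ord.
  by apply/setP=> k; rewrite !inE lt0n.
- apply/forallP=> u; apply/forallP=> v; apply/implyP.
  move=> /(enum_ends.2 u v).1 [e he].
  by apply/eqP; rewrite !vwE => h; apply: (wv_adj (e := e)); case: he => ->.
- apply/forallP=> e1; apply/forallP=> e2; apply/implyP=> /andP[ne].
  case/set0Pn=> u; rewrite inE.
  have [x xE] := edge_ofP enum_ends e1; have [y yE] := edge_ofP enum_ends e2.
  rewrite {}xE {}yE in ne *.
  rewrite !(mem_edge_of enum_ends) !ewE => /andP[ux uy].
  (* Both weights contain the label of the common vertex [u]; equality would force equal labels at
     the other ends, hence equal edges. *)
  apply: contraNneq ne; rewrite /we => eq_w; apply/eqP; congr edge_of.
  have lv_inj v v' : lv v = lv v' -> v = v'.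
    by move=> h; have [] := @lab_inj (inl v) (inl v') h.
  apply: enum_ends.1; move: eq_w ux uy; rewrite /incident.
  case: (ends x) (ends y) => [x1 x2] [y1 y2] /= eq_w.
  case/orP=> /eqP hx /orP[] /eqP hy; move: eq_w; rewrite -hx -hy.
  + by move/addnI/lv_inj->; left.
  + by rewrite (addnC _ (lv u)) => /addnI/lv_inj->; right.
  + by rewrite (addnC _ (lv u)) => /addnI/lv_inj->; right.
  + by move/addIn/lv_inj->; left.
- apply/forallP=> u; apply/forallP=> e; apply/implyP.
  have [x ->] := edge_ofP enum_ends e.
  rewrite (mem_edge_of enum_ends) vwE ewE.
  by case/orP=> /eqP ->; apply/eqP.
Qed.

End Upper.

(** The largest label is either on a vertex, and any edge there weighs more than every label, or on
    an edge, and its end with a second edge does. This weight is new beside the labels of the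
    pendant edges, which are distinct weights. *)
Lemma num_weights_pendant (J : finType) (pv : J -> G) (pe : J -> E)
    (f : labeling G) :
  total_labeling f -> 0 < #|G| -> injective pe ->
  (forall j e, incident ends (pv j) e = (e == pe j)) ->
  (forall u, exists e, incident ends u e) ->
  (forall e, exists u e',
     [/\ e' != e, incident ends u e & incident ends u e']) ->
  #|J|.+1 <= num_weights f.
Proof.
move=> /andP[/injectiveP f_inj /eqP f_im] G_gt0 pe_inj pendant noniso two_ends.
have vwE := vertex_weight_enum enum_ends f.
have f_gt0 x : 0 < f x.
  have : f x \in f @: setT by apply: imset_f.
  by rewrite f_im inE.
have vw_pendant j : vertex_weight f (pv j) = f (inr (edge_of (pe j))).
  by rewrite vwE /star_sum (eq_bigl _ _ (pendant j)) big_pred1_eq.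
have [x big_x] : exists x, order_size G < weight f x.
  have : (ord_max : 'I_(order_size G).+1) \in f @: setT.
    by rewrite f_im inE /= /order_size addn_gt0 G_gt0.
  case/imsetP=> -[u|e] _ fmax.
    have [e ue] := noniso u; exists (inr (edge_of e)) => /=.
    rewrite (edge_weight_enum enum_ends).
    have fu : order_size G = f (inl u) by rewrite -fmax.
    have := f_gt0 (inl (ends e).1); have := f_gt0 (inl (ends e).2).
    by case/orP: ue => /eqP eq_u; rewrite eq_u in fu; lia.
  have [e0 he0] := edge_ofP enum_ends e; rewrite {}he0 in fmax.
  have [u [e' [ne ue ue']]] := two_ends e0; exists (inl u) => /=.
  have fe : order_size G = f (inr (edge_of e0)) by rewrite -fmax.
  rewrite vwE /star_sum (bigD1 e0) //= (bigD1 e') /=; last by rewrite ne andbT.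
  by rewrite -fe ltnNge -[leqRHS]addn0 leq_add2l -ltnNge addn_gt0 f_gt0.
pose s := weight f x :: [seq (f (inr (edge_of (pe j))) : nat) | j : J].
have -> : #|J|.+1 = size s by rewrite /= size_map -cardE.
apply: uniq_leq_size => [/=|w]; last first.
  rewrite mem_undup inE => /orP[/eqP ->|/mapP[j _ ->]]; first exact: codom_f.
  by rewrite -vw_pendant; apply: (codom_f (weight f) (inl (pv j))).
apply/andP; split.
  apply/negP=> /mapP[j _ h]; move: big_x; rewrite h ltnNge -ltnS.
  by rewrite ltn_ord.
rewrite map_inj_uniq ?enum_uniq // => i j /val_inj/f_inj eq_ij.
by case: eq_ij => eq_ij; apply/pe_inj/(@edge_of_inj _ _ _ enum_ends)/val_inj.
Qed.

End Labelings.

(** * Edges and pendant vertices of mC6 + nP6 + aP3 *)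

(** The boolean selects an end of the path, [true] being the last one. *)
Definition pendant (n a : nat) := ('I_n * bool + 'I_a * bool)%type.

Lemma card_pendant n a : #|{: pendant n a}| = 2 * n + 2 * a.
Proof. by rewrite card_sum !card_prod !card_ord card_bool; lia. Qed.

Section Construction.

Variables m n a : nat.

Definition edge_index : finType :=
  ('I_m * 'I_6 + 'I_n * 'I_5 + 'I_a * 'I_2)%type.

Definition C6_P6_P3_ends :
    edge_index -> C6_P6_P3 m n a * C6_P6_P3 m n a :=
  union_ends
    (union_ends (copies_ends (@cycle_ends 6)) (copies_ends (@path_ends 5)))
    (copies_ends (@path_ends 2)).

Lemma edge_enum_C6_P6_P3 : edge_enum C6_P6_P3_ends.
Proof.
apply: edge_enum_union; last exact/edge_enum_copies/edge_enum_path.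
by apply: edge_enum_union; apply: edge_enum_copies;
  [apply: edge_enum_cycle|apply: edge_enum_path].
Qed.

Lemma card_C6_P6_P3 :
  #|C6_P6_P3 m n a| + #|edge_index| = 12 * m + 11 * n + 5 * a.
Proof. by rewrite !card_sum !card_prod !card_ord; lia. Qed.

Definition pendant_edge (x : pendant n a) : edge_index :=
  match x with
  | inl (i, b) => inl (inr (i, if b then ord_max else ord0))
  | inr (i, b) => inr (i, if b then ord_max else ord0)
  end.

Definition pendant_vertex (x : pendant n a) : C6_P6_P3 m n a :=
  match x with
  | inl (i, b) => inl (inr (i, if b then ord_max else ord0))
  | inr (i, b) => inr (i, if b then ord_max else ord0)
  end.

Lemma num_weights_ge (hn : 0 < n) (f : labeling (C6_P6_P3 m n a)) :
  local_total_antimagic f -> 2 * n + 2 * a + 1 <= num_weights f.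
Proof.
case/and4P=> f_total _ _ _.
rewrite addn1 -card_pendant.
apply: (num_weights_pendant edge_enum_C6_P6_P3 (pv := pendant_vertex)
  (pe := pendant_edge) f_total).
- by apply/card_gt0P; exists (inl (inr (Ordinal hn, ord0))).
- by move=> [] [i b] [] [j b'] //= [-> eq_b]; case: b b' eq_b => -[].
- move=> [] [i b] [[[k j]|[k j]]|[k j]] //=.
  + rewrite [LHS]incident_copies incident_path_end.
   by rewrite -xpair_eqE.
  + rewrite [LHS]incident_copies incident_path_end.
   by rewrite -xpair_eqE.
- case=> [[[i v]|[i v]]|[i v]].
  + exists (inl (inl (i, v))).
    by rewrite /is_true [LHS]incident_copies /incident !eqxx.
  + have [e he] := path_vertex_incident v.
    by exists (inl (inr (i, e))); rewrite /is_true [LHS]incident_copies eqxx.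
  + have [e he] := path_vertex_incident v.
    by exists (inr (i, e)); rewrite /is_true [LHS]incident_copies eqxx.
- case=> [[[i j]|[i j]]|[i j]].
  + exists (inl (inl (i, j))), (inl (inl (i, ord_pred j))).
    split.
    * rewrite -[_ == _]/((i, _) == (i, _)) xpair_eqE eqxx /=.
      have := ends_neq (edge_enum_cycle 3) (ord_pred j).
      by rewrite /= ord_predK.
    * by rewrite /is_true [LHS]incident_copies /incident !eqxx.
    * rewrite /is_true [LHS]incident_copies /incident /= ord_predK.
      by rewrite !eqxx orbT.
  + have [u [e' [ne ue ue']]] := path_edge_neighbor j.
    exists (inl (inr (i, u))), (inl (inr (i, e'))).
    split; last 2 first; try by rewrite /is_true [LHS]incident_copies eqxx.
    by rewrite -[_ == _]/((i, _) == (i, _)) xpair_eqE eqxx.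
  + have [u [e' [ne ue ue']]] := path_edge_neighbor j.
    exists (inr (i, u)), (inr (i, e')).
    split; last 2 first; try by rewrite /is_true [LHS]incident_copies eqxx.
    by rewrite -[_ == _]/((i, _) == (i, _)) xpair_eqE eqxx.
Qed.

End Construction.

(** * The labeling *)

Section Labels.

Variables m n a M : nat.
Hypothesis n_gt0 : 0 < n.
Hypothesis M_def : M = 12 * m + 11 * n + 5 * a + 1.

(* [B], [p1], [p2] count the low labels used up to the end of the hexagons,
   of the P3 vertices and of all blocks; [B + 1], [q1], [q2] count the high
   labels. *)
Definition B := a + 2 + 3 * (2 * m + n).

(** [t] is the next free low label: the blocks before the hexagons take [a + 2] low and [a + 3] high
    labels, and each hexagon takes three of each. *)
Definition hexagon i : seq nat :=
  let t := a + 3 + 3 * i in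
  [:: t + 1; M - (t + 1); t; M - (t + 2); t + 2; M - (t + 3)].

(** The first P6 takes 2 low and 3 high labels, which creates the excess 1 that hexagons require.
    For the others, [p] low labels are already used, and the parity of [a + j] tells whether the
    excess is 2 (take 3 low, 2 high) or 1 (take 2 low, 3 high). *)
Definition P6_edges i : seq nat :=
  if i is j.+1 then
    let p := B + (3 * a + 5 * j)./2 in
    if odd (a + j)
    then [:: p + 1; M - (p + 3); p + 3; M - (p + 4); p + 2]
    else [:: M - (p + 4); p + 2; M - (p + 2); p + 1; M - (p + 3)]
  else [:: M - (a + 1); a + 1; M - (a + 3); a + 2; M - (a + 2)].

Definition P3_edges i : seq nat := [:: M - (i + 1); i + 1].

(** The parity also fixes the order of the edge weights: the initial vertices of the first two P3's
    weigh [M - 1] and [M - 2], and their edges there get [M - 2] and [M - 1]. *)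
Definition P3_vertices i : seq nat :=
  let p := B + (3 * i)./2 in
  if odd i then [:: p + 2; M - (p + 3); p + 1]
  else [:: M - (p + 3); p + 1; M - (p + 2)].

(** Low labels are counted up from 0 and high ones down from [M]. Groups of blocks occupy disjoint
    bands, which separates their labels. *)
Definition in_band p p' q q' l := (p < l <= p') \/ (q < M - l <= q' /\ l < M).

Lemma hexagon_band i j : i < 2 * m + n -> j < 6 ->
  in_band (a + 2) B (a + 3) (B + 1) (nth 0 (hexagon i) j).
Proof.
by rewrite /in_band /B => hi; case: j => [|[|[|[|[|[|j]]]]]] //= _; lia.
Qed.

Lemma hexagon_inj i i' j j' :
  i < 2 * m + n -> i' < 2 * m + n -> j < 6 -> j' < 6 ->
  nth 0 (hexagon i) j = nth 0 (hexagon i') j' -> i = i' /\ j = j'.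
Proof.
by move=> hi hi'; case: j => [|[|[|[|[|[|j]]]]]] //= _;
  case: j' => [|[|[|[|[|[|j']]]]]] //= _; lia.
Qed.

Lemma P3_edges_band i j : i < a -> j < 2 ->
  in_band 0 a 0 a (nth 0 (P3_edges i) j).
Proof. by rewrite /in_band => hi; case: j => [|[|j]] //= _; lia. Qed.

Lemma P3_edges_inj i i' j j' : i < a -> i' < a -> j < 2 -> j' < 2 ->
  nth 0 (P3_edges i) j = nth 0 (P3_edges i') j' -> i = i' /\ j = j'.
Proof.
move=> hi hi'; case: j => [|[|j]] //= _; case: j' => [|[|j']] //= _; lia.
Qed.

Definition p1 := B + (3 * a)./2.
(** The excess starts at 1 and is toggled by each of the [a] P3's. *)
Definition q1 := p1 + 1 + odd a.

Lemma P3_vertices_band i j : i < a -> j < 3 ->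
  in_band B p1 (B + 1) q1 (nth 0 (P3_vertices i) j).
Proof.
rewrite /in_band /q1 /p1 /P3_vertices /B => hi.
by case: j => [|[|[|j]]] //= _; case: ifP => /=; lia.
Qed.

Lemma P3_vertices_inj i i' j j' :
  i < a -> i' < a -> j < 3 -> j' < 3 ->
  nth 0 (P3_vertices i) j = nth 0 (P3_vertices i') j' -> i = i' /\ j = j'.
Proof.
rewrite /P3_vertices /B => hi hi'.
by case: j => [|[|[|j]]] //= _; case: j' => [|[|[|j']]] //= _;
  case: ifP => odd_i; case: ifP => odd_i' /=; lia.
Qed.

(** All [M - 1] labels are used with a final excess of 1 or 2, which forces this value. *)
Definition p2 := (M - 2)./2.
Definition q2 := M - 1 - p2.

(** [3 * a + 5 * k] and [a + k] have the same parity; this makes the halving linear for [lia]. *)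
Let half_P6 k : 2 * (3 * a + 5 * k)./2 + odd (a + k) = 3 * a + 5 * k.
Proof. lia. Qed.

Lemma P6_edges_band i j : i < n -> j < 5 ->
  in_band p1 p2 q1 q2 (nth 0 (P6_edges i) j) \/
  in_band a (a + 2) a (a + 3) (nth 0 (P6_edges i) j).
Proof.
rewrite /in_band /q1 /q2 /p2 /p1; case: i => [|i] hi /=; rewrite /B.
  by case: j => [|[|[|[|[|j]]]]] //= _; right; lia.
have := half_P6 i; have := half_P6 0.
have : 2 * (M - 2)./2 <= M - 2 < 2 * (M - 2)./2 + 2 by lia.
(* The halves become variables constrained only by the linear facts above. *)
rewrite muln0 !addn0; move: (_ - _)./2 (3 * a)./2 (3 * a + _)./2 => r q q'.
case: (odd a); case: (odd _); case: j => [|[|[|[|[|j]]]]] //= *; left; lia.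
Qed.

Lemma P6_edges_inj i i' j j' : i < n -> i' < n -> j < 5 -> j' < 5 ->
  nth 0 (P6_edges i) j = nth 0 (P6_edges i') j' -> i = i' /\ j = j'.
Proof.
rewrite /P6_edges; case: i => [|i] hi; case: i' => [|i'] hi';
  try (have := half_P6 i; move: _./2 => q; case: (odd (a + i)));
  try (have := half_P6 i'; move: _./2 => q'; case: (odd (a + i')));
  rewrite /B; case: j => [|[|[|[|[|j]]]]] //=;
  case: j' => [|[|[|[|[|j']]]]] //= *; lia.
Qed.

(** The last equation separates low from high: a label [l] with [M - l <= q2] is at least
    [p2 + 1]. *)
Lemma band_bounds :
  [/\ B <= p1, p1 <= p2, B + 1 <= q1, q1 <= q2 & p2 + q2 + 1 = M].
Proof. by rewrite /q2 /p2 /q1 /p1 /B; split; lia. Qed.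

(** * Coding of vertices and edges by positions in blocks *)

Definition block k : nat -> seq nat :=
  match k with
  | 0 => hexagon | 1 => P3_edges | 2 => P3_vertices | _ => P6_edges
  end.

(* A triple (kind of block, index of the block, position in the block). *)
Definition valid (c : nat * nat * nat) : bool :=
  let: (k, i, j) := c in
  match k with
  | 0 => (i < 2 * m + n) && (j < 6)
  | 1 => (i < a) && (j < 2)
  | 2 => (i < a) && (j < 3)
  | 3 => (i < n) && (j < 5)
  | _ => false
  end.

Definition block_label (c : nat * nat * nat) : nat :=
  let: (k, i, j) := c in nth 0 (block k i) j.

Lemma block_label_band c : valid c ->
  let l := block_label c in
  match c.1.1 with
  | 0 => in_band (a + 2) B (a + 3) (B + 1) l
  | 1 => in_band 0 a 0 a l
  | 2 => in_band B p1 (B + 1) q1 l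
  | _ => in_band p1 p2 q1 q2 l \/ in_band a (a + 2) a (a + 3) l
  end.
Proof.
case: c => -[[|[|[|[|k]]]] i] j //= /andP[hi hj].
- exact: hexagon_band.
- exact: P3_edges_band.
- exact: P3_vertices_band.
- exact: P6_edges_band.
Qed.

Lemma block_label_range c : valid c -> 0 < block_label c < M.
Proof.
move=> hc; have := block_label_band hc.
have [] := band_bounds; have : a + 2 <= B by rewrite /B; lia.
by case: c hc => -[[|[|[|[|k]]]] i] j // _; rewrite /in_band /=; lia.
Qed.

(** Labels of different kinds lie in disjoint bands; within one kind, the injectivity of that family
    of blocks applies. *)
Lemma block_label_inj : {in valid &, injective block_label}.
Proof.
move=> c c' hc hc'; have := block_label_band hc; have := block_label_band hc'.
have [] := band_bounds; have : a + 3 <= B by rewrite /B; lia.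
case: c hc => -[[|[|[|[|k]]]] i] j // /andP[hi hj];
case: c' hc' => -[[|[|[|[|k']]]] i'] j' // /andP[hi' hj'];
  rewrite /in_band [c in _ -> _ -> c]/= => *; try (exfalso; lia).
- by have [] := @hexagon_inj i i' j j'; [..|move=> -> ->].
- by have [] := @P3_edges_inj i i' j j'; [..|move=> -> ->].
- by have [] := @P3_vertices_inj i i' j j'; [..|move=> -> ->].
- by have [] := @P6_edges_inj i i' j j'; [..|move=> -> ->].
Qed.

(* The first P6 traverses its hexagon backwards, and the edges of a C6 start at
   position 2 of theirs, to align the period 3 of vertex and edge weights. *)
Definition vertex_code (u : C6_P6_P3 m n a) : nat * nat * nat :=
  match u with
  | inl (inl (i, v)) => (0, val i, val v)
  | inl (inr (i, v)) => (0, 2 * m + i, if val i == 0 then (6 - v) %% 6 else v)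
  | inr (i, v) => (2, val i, val v)
  end.

Definition edge_code (e : edge_index m n a) : nat * nat * nat :=
  match e with
  | inl (inl (i, j)) => (0, m + i, (j + 2) %% 6)
  | inl (inr (i, j)) => (3, val i, val j)
  | inr (i, j) => (1, val i, val j)
  end.

Definition code (x : C6_P6_P3 m n a + edge_index m n a) :=
  match x with inl u => vertex_code u | inr e => edge_code e end.

Lemma code_valid x : valid (code x).
Proof.
case: x => [[[[i v]|[i v]]|[i v]]|[[[i v]|[i v]]|[i v]]] /=.
- by have := ltn_ord i; have := ltn_ord v; lia.
- by have := ltn_ord i; have := ltn_ord v; case: ifP; lia.
- by rewrite !ltn_ord.
- by have := ltn_ord i; have := ltn_ord v; lia.
- by rewrite !ltn_ord.
- by rewrite !ltn_ord.
Qed.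

(** Hexagons below [m], from [m] to [2 * m - 1], and from [2 * m] on serve C6 vertices, C6 edges and
    P6 vertices respectively. *)
Lemma code_inj : injective code.
Proof.
have eq_pair (p q : nat) (i i' : 'I_p) (j j' : 'I_q) :
    i = i' :> nat -> j = j' :> nat -> (i, j) = (i', j').
  by move=> /val_inj -> /val_inj ->.
move=> [[[[i v]|[i v]]|[i v]]|[[[i v]|[i v]]|[i v]]]
  [[[[i' v']|[i' v']]|[i' v']]|[[[i' v']|[i' v']]|[i' v']]] //= [];
  have := ltn_ord i; have := ltn_ord i'; have := ltn_ord v; have := ltn_ord v';
  move=> hv' hv hi' hi eq_i eq_v; try (exfalso; lia);
  do ?congr (_ _); apply: eq_pair; try lia.
(* Two P6 vertices remain: once the copies agree, both positions follow the same branch. *)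
have eq_ii : i = i' :> nat by lia.
by move: eq_v; rewrite eq_ii; case: ifP; lia.
Qed.

Definition label x := block_label (code x).

(** * Weights of the labeling *)

Let wv := star_sum (@C6_P6_P3_ends m n a) (fun e => label (inr e)).
Let we e := label (inl (C6_P6_P3_ends e).1) + label (inl (C6_P6_P3_ends e).2).

(** The shift by 2 in [edge_code] gives vertex [v] the offset [v + 1] modulo 3, unlike the offsets
    [v - 1] and [v] of its edges and [v], [v + 2] of its neighbors. *)
Lemma C6_vertex_weight i v : wv (inl (inl (i, v))) = M - (v + 1) %% 3.
Proof.
rewrite /wv [LHS]star_sum_inl star_sum_inl star_sum_copies star_sum_cycle.
rewrite /label /=; have := ltn_ord i.
by case: v => [[|[|[|[|[|[|v]]]]]] hv] //=; lia.
Qed.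

Lemma C6_edge_weight i j : we (inl (inl (i, j))) = M - j %% 3.
Proof.
rewrite /we /label /=; have := ltn_ord i.
by case: j => [[|[|[|[|[|[|j]]]]]] hj] //=; lia.
Qed.

Lemma P6_vertex_weight i v : wv (inl (inr (i, v))) =
  (if 0 < v then nth 0 (P6_edges i) v.-1 else 0) +
  (if v < 5 then nth 0 (P6_edges i) v else 0).
Proof.
rewrite /wv [LHS]star_sum_inl star_sum_inr star_sum_copies.
exact: (star_sum_path (fun j => nth 0 (P6_edges i) j) v).
Qed.

Lemma P6_edge_weight i j :
  we (inl (inr (i, j))) = M - (if i == 0 :> nat then 5 - j else j : nat) %% 3.
Proof.
rewrite /we /label /= /bump leq0n add1n; have := ltn_ord i.
by case: j => [[|[|[|[|[|j]]]]] hj] //=; case: ifP => /=; lia.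
Qed.

(** Modulo 3 the offset differs from those of edges [v - 1] and [v]: these are [6 - v] and [5 - v]
    in the first P6, [v - 1] and [v] in the others. *)
Lemma P6_inner_weight i (v : nat) : 0 < v < 5 ->
  i < n -> nth 0 (P6_edges i) v.-1 + nth 0 (P6_edges i) v =
   M - (if i == 0 then 4 - v else v + 1) %% 3.
Proof.
move=> hv hi; case: i hi => [|i] hi /=; rewrite /B.
  by case: v hv => [|[|[|[|[|v]]]]] //= _; lia.
have := half_P6 i; case: (odd _); move: _./2 => q.
  by case: v hv => [|[|[|[|[|v]]]]] //= _; lia.
by case: v hv => [|[|[|[|[|v]]]]] //= _; lia.
Qed.

Lemma P3_vertex_weight i v : wv (inr (i, v)) =
  (if 0 < v then nth 0 (P3_edges i) v.-1 else 0) +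
  (if v < 2 then nth 0 (P3_edges i) v else 0).
Proof.
rewrite /wv [LHS]star_sum_inr star_sum_copies.
exact: (star_sum_path (fun j => nth 0 (P3_edges i) j) v).
Qed.

Lemma P3_edge_weight i j :
  we (inr (i, j)) = M - (if odd i then j.+1 else 2 - j).
Proof.
rewrite /we /label /= /bump leq0n add1n /P3_vertices /B; have := ltn_ord i.
by case: j => [[|[|j]] hj] //=; case: ifP => /=; lia.
Qed.

(** The edges of at least two P3's have already taken [M - 1] and [M - 2]. Pendant weights of a P6
    thus avoid all weights [M], [M - 1], [M - 2] nearby. *)
Lemma P6_pendant_label i j : 2 <= a -> i < n -> j < 5 ->
  nth 0 (P6_edges i) j < M - 2.
Proof.
move=> ha hi; case: i hi => [|i] hi /=; rewrite /B.
  by case: j => [|[|[|[|[|j]]]]] //= _; lia.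
by case: ifP => _; case: j => [|[|[|[|[|j]]]]] //= _; lia.
Qed.

Lemma incident_weights_neq e : 2 <= a ->
  [/\ wv (C6_P6_P3_ends e).1 <> wv (C6_P6_P3_ends e).2,
      wv (C6_P6_P3_ends e).1 <> we e & wv (C6_P6_P3_ends e).2 <> we e].
Proof.
move=> ha.
case: e => [[[i j]|[i j]]|[i j]]; have hi := ltn_ord i; have hj := ltn_ord j.
- by rewrite !C6_vertex_weight C6_edge_weight /=; split; lia.
- rewrite !P6_vertex_weight P6_edge_weight !lift0 /=.
  have first : nth 0 (P6_edges i) 0 < M - 2 by apply: P6_pendant_label.
  have last : nth 0 (P6_edges i) 4 < M - 2 by apply: P6_pendant_label.
  have inner v := @P6_inner_weight i v^~ hi.
  have := inner 1 isT; have := inner 2 isT; have := inner 3 isT.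
  have := inner 4 isT.
  case: j hj => [[|[|[|[|[|j]]]]] hj] //= _; case: ifP => _ /= *; split; lia.
(* The middle vertex weighs [M]. The pendant weight [M - (i + 1)] could meet an edge weight only for
   [i] equal to 0 or 1, where the parity rule separates them. *)
- rewrite !P3_vertex_weight P3_edge_weight !lift0 /=.
  by case: j hj => [[|[|j]] hj] //= _; case: ifP => odd_i /=; split; lia.
Qed.

Let weight_values :=
  M :: [seq label (inr (@pendant_edge m n a x)) | x : pendant n a].

Lemma size_weight_values : size weight_values = 2 * n + 2 * a + 1.
Proof. by rewrite /= size_map -cardE card_pendant addn1. Qed.

(** [M - 1] and [M - 2] are the labels of the initial edges of P3's number 0 and 1, so among the
    three values only [M] adds to the pendant weights. *)
Lemma top_weight_values k : 2 <= a -> k < 3 -> M - k \in weight_values.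
Proof.
move=> ha; case: k => [|[|[|k]]] // _; rewrite inE ?subn0 ?eqxx //;
  apply/orP; right.
- have a_gt0 : 0 < a by lia.
  by apply/imageP; exists (inr (Ordinal a_gt0, false)).
- have a_gt1 : 1 < a by lia.
  by apply/imageP; exists (inr (Ordinal a_gt1, false)).
Qed.

Lemma vertex_weight_values u : 2 <= a -> wv u \in weight_values.
Proof.
move=> ha; case: u => [[[i v]|[i v]]|[i v]].
- by rewrite C6_vertex_weight top_weight_values // ltn_mod.
- have hv := ltn_ord v; rewrite P6_vertex_weight.
  have [v0|v0] := posnP v.
    rewrite v0 /= inE; apply/orP; right.
    by apply/imageP; exists (inl (i, false)).
  have [v5|v5] := ltnP v 5.
    by rewrite P6_inner_weight ?v0 ?v5 // top_weight_values // ltn_mod.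
  rewrite addn0 inE (_ : (v : nat) = 5) /=; last by lia.
  by apply/orP; right; apply/imageP; exists (inl (i, true)).
- have hi := ltn_ord i; rewrite P3_vertex_weight.
  case: v => [[|[|[|v]]] hv] //=.
  + rewrite inE; apply/orP; right.
    by apply/imageP; exists (inr (i, false)).
  + by rewrite (_ : _ + _ = M - 0) ?top_weight_values //; lia.
  + rewrite inE; apply/orP; right.
    by apply/imageP; exists (inr (i, true)); rewrite // addn0.
Qed.

Lemma edge_weight_values e : 2 <= a -> we e \in weight_values.
Proof.
move=> ha; case: e => [[[i j]|[i j]]|[i j]].
- by rewrite C6_edge_weight top_weight_values // ltn_mod.
- by rewrite P6_edge_weight top_weight_values // ltn_mod.
- rewrite P3_edge_weight top_weight_values //.
  by have := ltn_ord j; case: ifP; lia.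
Qed.

Lemma label_antimagic : 2 <= a ->
  exists2 f : labeling (C6_P6_P3 m n a),
    local_total_antimagic f & num_weights f <= 2 * n + 2 * a + 1.
Proof.
move=> ha; rewrite -size_weight_values.
have labelE x : match x with
    | inl u => label (inl u) | inr e => label (inr e) end = label x by case: x.
apply: (antimagic_of_enum (edge_enum_C6_P6_P3 m n a)
  (lv := fun u => label (inl u)) (le := fun e => label (inr e))).
- move=> x y; rewrite !labelE => eq_xy; apply: code_inj.
  by apply: block_label_inj eq_xy; apply: code_valid.
- move=> x; rewrite labelE card_C6_P6_P3.
  have := block_label_range (code_valid x).
  by rewrite -/(label x); lia.
- by move=> e; case: (incident_weights_neq e ha).
- by move=> e; case: (incident_weights_neq e ha).
- by move=> e; case: (incident_weights_neq e ha).
- by move=> u; apply: vertex_weight_values.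
- by move=> e; apply: edge_weight_values.
Qed.

End Labels.

Theorem theorem4p4 (m n a : nat) (hm : 1 <= m) (hn : 1 <= n) (ha : 2 <= a) :
  let chi := chi_lt (C6_P6_P3 m n a) in
  let L := 2 * n + 2 * a + 1 in
  ((2 * a + 2 <= n) \/ (2 * n <= a) -> chi = L)
  /\
  (~ ((2 * a + 2 <= n) \/ (2 * n <= a)) ->
    [/\ (n = 2 * a + 1) \/ (n + 1 <= a <= 2 * n - 1) ->
          L <= chi <= 2 * n + 2 * a + 2,
        (n = 2 * a) \/ (a = n) ->
          L <= chi <= 2 * n + 2 * a + 3,
        (a + 1 <= n <= 2 * a - 1) \/ (a = n - 1) ->
          L <= chi <= 2 * n + 2 * a + 4
      & (n <= a) \/ (a <= n - 2) ->
          L <= chi <= 2 * n + 2 * a + 5]).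
Proof.
have -> : chi_lt (C6_P6_P3 m n a) = 2 * n + 2 * a + 1.
  apply: chi_lt_eq; first exact: label_antimagic hn erefl ha.
  by move=> f; apply: num_weights_ge.
(* With the exact value known, each range reduces to comparing 1 with 2, 3, 4 or 5. *)
by move=> /=; split=> // _; split=> _; rewrite leqnn leq_add2l.
Qed.
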